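(* Let $\mathcal{L}(p)=\int_a^bp(t)\,d\mu(t)$, where $d\mu$ is a positive measure with support contained in the interval $[a,b]\subset\mathbb{R}$ and such that $\mathcal{L}$ is positive-definite. Let $\kappa\in\mathbb{C}_\pm$ and $s_0^*=\int_a^b\frac{d\mu(t)}{t-\kappa}$. Then the polynomials $P_n^{-*}(\kappa,z)$ corresponding to the Geronimus transformation of $\mathcal{L}$ at $\kappa$ with parameter $s_0^*$ are correctly defined for each $n$, and they are orthogonal with respect to the complex-valued measure $\frac{d\mu(t)}{t-\kappa}$. Moreover, if one further sets $s_0^{**}=\int_a^b\frac{d\mu(t)}{|t-\kappa|^2}$, then the resulting iterated polynomials $P_n^{-**}(\kappa,\overline{\kappa},z)$ are correctly defined for each $n$, and they are orthogonal with respect to the positive measure $\frac{d\mu(t)}{|t-\kappa|^2}$.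
   Context: $\mathbb{C}_\pm=\{z\in\mathbb{C}:\pm\operatorname{Im}z>0\}$; $\kappa\in\mathbb{C}_\pm$ means $\kappa$ is nonreal. A functional $\mathcal{L}$ on $\mathbb{C}[z]$ is positive-definite if $\mathcal{L}[p]>0$ for every polynomial $p$ that is not identically zero and is non-negative on $\mathbb{R}$. A sequence of polynomials $p_n$ with $\deg p_n=n$ is orthogonal with respect to a functional $\mathcal{M}$ (or the measure representing it) if $\mathcal{M}[p_np_m]=0$ for $n\ne m$ and $\mathcal{M}[p_n^2]\neq0$ for all $n$; it is then called an OPS (note that no complex conjugation is involved). $\{P_n\}$ denotes the monic OPS of $\mathcal{L}$. A Geronimus transformation of $\mathcal{L}$ at $\kappa$ with parameter $s_0^*$ is the functional $\mathcal{L}^{-*}$ determined by $\mathcal{L}^{-*}((z-\kappa)p(z))=\mathcal{L}(p(z))$ for all polynomials $p$ and $\mathcal{L}^{-*}(1)=s_0^*$. With $Q_n(z)=\mathcal{L}\left(\frac{P_n(z)-P_n(y)}{z-y}\right)_y$ (functional acting in $y$), set $P_0^{-*}=1$ and $$P_n^{-*}(\kappa,z)=P_n(z)-\frac{s_0^*P_n(\kappa)+Q_n(\kappa)}{s_0^*P_{n-1}(\kappa)+Q_{n-1}(\kappa)}P_{n-1}(z),\quad n\ge1;$$ these are ''correctly defined'' if $s_0^*P_{n-1}(\kappa)+Q_{n-1}(\kappa)\neq0$ for all $n\ge1$. The iterated polynomials are obtained by applying the same construction to $\mathcal{L}^{-*}$ at the second point $\kappa_2=\overline\kappa$ with parameter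 $s_0^{**}$: with $Q_n^{-*}(\kappa,z)=\mathcal{L}^{-*}\left(\frac{P_n^{-*}(\kappa,z)-P_n^{-*}(\kappa,y)}{z-y}\right)_y$, set $P_0^{-**}=1$ and $$P_n^{-**}(\kappa,\kappa_2,z)=P_n^{-*}(\kappa,z)-\frac{s_0^{**}P_n^{-*}(\kappa,\kappa_2)+Q_n^{-*}(\kappa,\kappa_2)}{s_0^{**}P_{n-1}^{-*}(\kappa,\kappa_2)+Q_{n-1}^{-*}(\kappa,\kappa_2)}P_{n-1}^{-*}(\kappa,z),\quad n\ge1;$$ these are ''correctly defined'' if all the denominators are nonzero. *)

(* Defs.v *)
From HB Require Import structures.
From mathcomp Require Import all_boot all_order all_algebra.
From mathcomp Require Import all_classical all_reals all_analysis.
From mathcomp Require Import complex.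

Set Implicit Arguments.
Unset Strict Implicit.
Unset Printing Implicit Defensive.

Import Order.TTheory GRing.Theory Num.Theory.
Import numFieldNormedType.Exports.

Local Open Scope classical_set_scope.
Local Open Scope ring_scope.
Local Open Scope complex_scope.

Definition is_OPS (F : fieldType) (M : {poly F} -> F) (p : nat -> {poly F}) :=
  [/\ forall n, size (p n) = n.+1,
      forall n m, n <> m -> M (p n * p m) = 0
    & forall n, M (p n ^+ 2) <> 0].

Definition is_monic_OPS (F : fieldType) (M : {poly F} -> F)
    (p : nat -> {poly F}) :=
  (forall n, p n \is monic) /\ is_OPS M p.

(* The functional acts in the variable y of (p(z) - p(y)) / (z - y), which is
   the poly variable here; the division is exact. *)
Definition second_kind (F : fieldType) (M : {poly F} -> F)
    (p : {poly F}) (z : F) : F :=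
  M ((p.[z]%:P - p) %/ (z%:P - 'X)).

Definition is_geronimus (F : fieldType) (M : {poly F} -> F) (kappa s : F)
    (Ms : {poly F} -> F) :=
  [/\ scalar Ms,
      forall p : {poly F}, Ms (('X - kappa%:P) * p) = M p
    & Ms 1 = s].

Lemma is_geronimus_ex (F : fieldType) (M : {poly F} -> F) (kappa s : F) :
  scalar M -> exists Ms, is_geronimus M kappa s Ms.
Proof.
move=> linM.
have nz : 'X - kappa%:P != 0 :> {poly F} by rewrite polyXsubC_eq0.
exists (fun p => M ((p - p.[kappa]%:P) %/ ('X - kappa%:P)) + s * p.[kappa]).
split=> [c p q|p|].
- rewrite hornerD hornerZ.
  have -> : c *: p + q - (c * p.[kappa] + q.[kappa])%:P =
            c *: (p - p.[kappa]%:P) + (q - q.[kappa]%:P).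
    by rewrite polyCD polyCM mul_polyC scalerBr opprD addrACA.
  by rewrite (divpD _ (c *: _)) divpZl linM !mulrDr addrACA mulrCA.
- by rewrite hornerM hornerXsubC subrr mul0r subr0 mulr0 addr0 mulKp.
- rewrite hornerC subrr div0p mulr1.
  have := linM (-1) 0 0; rewrite scaler0 addr0 mulN1r addNr => ->.
  by rewrite add0r.
Qed.

Lemma is_geronimus_uniq (F : fieldType) (M : {poly F} -> F) (kappa s : F)
    (M1 M2 : {poly F} -> F) :
  is_geronimus M kappa s M1 -> is_geronimus M kappa s M2 -> M1 =1 M2.
Proof.
move=> [lin1 M1E M1s] [lin2 M2E M2s] p.
have /factor_theorem[q pE] : root (p - p.[kappa]%:P) kappa.
  by rewrite /root hornerD hornerN hornerC subrr.
have {pE} -> : p = p.[kappa] *: 1 + ('X - kappa%:P) * q.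
  by rewrite mulrC -pE alg_polyC addrCA subrr addr0.
by rewrite lin1 lin2 M1E M2E M1s M2s.
Qed.

Definition geronimus_den (F : fieldType) (M : {poly F} -> F)
    (p : nat -> {poly F}) (kappa s : F) (n : nat) : F :=
  s * (p n).[kappa] + second_kind M (p n) kappa.

Definition geronimus_poly (F : fieldType) (M : {poly F} -> F)
    (p : nat -> {poly F}) (kappa s : F) (n : nat) : {poly F} :=
  if n is m.+1 then
    p m.+1 - (geronimus_den M p kappa s m.+1 / geronimus_den M p kappa s m)
               *: p m
  else 1.

Definition geronimus_correct (F : fieldType) (M : {poly F} -> F)
    (p : nat -> {poly F}) (kappa s : F) :=
  forall n, (1 <= n)%N -> geronimus_den M p kappa s n.-1 <> 0.

Definition cintegral (R : realType)
    (mu : {measure set (measurableTypeR R) -> \bar R}) (D : set R)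
    (f : R -> R[i]) : R[i] :=
  (\int[mu]_(t in D) complex.Re (f t)) +i* (\int[mu]_(t in D) complex.Im (f t)).

Definition integral_functional (R : realType)
    (mu : {measure set (measurableTypeR R) -> \bar R}) (D : set R)
    (p : {poly R[i]}) : R[i] :=
  cintegral mu D (fun t => p.[t%:C]).

(* Integration against the (complex) measure w(t) dmu(t). *)
Definition density_functional (R : realType)
    (mu : {measure set (measurableTypeR R) -> \bar R}) (D : set R)
    (w : R -> R[i]) (p : {poly R[i]}) : R[i] :=
  cintegral mu D (fun t => p.[t%:C] * w t).

Definition measure_support (R : realType)
    (mu : {measure set (measurableTypeR R) -> \bar R}) : set R :=
  [set x : R | forall U : set R, open U -> U x -> (0%E < mu U)%E].

(* In R[i], 0 <= z and 0 < z entail that z is real. *)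
Definition positive_definite (R : realType) (M : {poly R[i]} -> R[i]) :=
  forall p : {poly R[i]},
    p <> 0 -> (forall t : R, 0 <= p.[t%:C]) -> 0 < M p.

(* Main.v *)
Require Import Defs.
From HB Require Import structures.
From mathcomp Require Import all_boot all_order all_algebra.
From mathcomp Require Import all_classical all_reals all_analysis.
From mathcomp Require Import complex ring.

Set Implicit Arguments.
Unset Strict Implicit.
Unset Printing Implicit Defensive.

Import Order.TTheory GRing.Theory Num.Theory.
Import numFieldNormedType.Exports.

Local Open Scope classical_set_scope.
Local Open Scope ring_scope.
Local Open Scope complex_scope.

(* If N is the Geronimus transform of M at kappa, then the denominator
   s P_n(kappa) + Q_n(kappa) is just N(P_n), and the transformed polynomials are
   an OPS for N as soon as no N(P_n) vanishes.  If N(P_n) = 0, then N(P_n r) = 0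
   for every r of degree at most n, since r - r(kappa) is divisible by z - kappa
   and P_n is M-orthogonal to the lower degrees.  Take r to be the polynomial
   with conjugate coefficients, so that P_n r = |P_n|^2 on the real line: for
   the density 1 / (t - kappa) the imaginary part of the integral is
   Im kappa times the integral of |P_n|^2 / |t - kappa|^2, which is positive;
   for the density 1 / |t - kappa|^2 the integral itself is positive. *)

(** * Expansion along a monic orthogonal sequence, over any field *)

Lemma size_sub_monic (F : fieldType) (p q : {poly F}) (n : nat) :
  p \is monic -> size p = n.+1 -> (size q <= n.+1)%N ->
  (size (q - q`_n *: p)%R <= n)%N.
Proof.
move=> /monicP pmonic ps qs; apply/leq_sizeP => j; rewrite leq_eqVlt coefB coefZ.
move=> /orP[/eqP <-|nj]; last first.
  rewrite (nth_default 0 (leq_trans qs nj)) [p`_j]nth_default ?ps //.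
  by rewrite mulr0 subrr.
by move: pmonic; rewrite /lead_coef ps /= => ->; rewrite mulr1 subrr.
Qed.

(** Induction on the size of [q]: subtracting the multiple of [P d] that carries the leading term
    leaves a shorter polynomial, and [d < n] makes the subtracted term orthogonal to [P n]. *)
Lemma OPS_orthogonal (F : fieldType) (M : {scalar {poly F}})
    (P : nat -> {poly F}) (P_OPS : is_monic_OPS M P) (n : nat) (q : {poly F}) :
  (size q <= n)%N -> M (P n * q) = 0.
Proof.
have [Pmonic [Psize Porth _]] := P_OPS.
have [m] := ubnP (size q); elim: m q n => // m IH q n /ltnSE qm qn.
have [->|q0] := eqVneq q 0; first by rewrite mulr0 linear0.
case sq: (size q) => [|d]; first by move/eqP: sq q0; rewrite size_poly_eq0 => ->.
have r_small : (size (q - q`_d *: P d)%R <= d)%N.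
  by rewrite size_sub_monic ?sq.
rewrite -(subrK (q`_d *: P d) q) mulrDr -scalerAr linearD scalarZ.
rewrite Porth => [|nd]; last by move: qn; rewrite sq nd ltnn.
rewrite sq in qm qn; rewrite mulr0 addr0.
by apply: IH; rewrite ?(leq_ltn_trans r_small) // (leq_trans r_small) // ltnW.
Qed.

(** Removing from [q] its multiple of the monic [P n] leaves degree below [n], which [P n]
    annihilates. *)
Lemma OPS_mul_coef (F : fieldType) (M : {scalar {poly F}})
    (P : nat -> {poly F}) (P_OPS : is_monic_OPS M P) (n : nat) (q : {poly F}) :
  (size q <= n.+1)%N -> M (P n * q) = q`_n * M (P n ^+ 2).
Proof.
move=> qn; have [Pmonic [Psize _ _]] := P_OPS.
rewrite -{1}(subrK (q`_n *: P n) q) mulrDr -scalerAr linearD scalarZ.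
by rewrite OPS_orthogonal // ?add0r ?expr2 // size_sub_monic.
Qed.

(** * Geronimus transforms of a functional, over any field *)

Lemma divp_XsubC (F : fieldType) (p : {poly F}) (c : F) :
  p = p %/ ('X - c%:P) * ('X - c%:P) + p.[c]%:P.
Proof. by rewrite -modp_XsubC -divp_eq. Qed.

(** Divide [r] by ['X - kappa%:P]: the remainder is the value at [kappa], and on the other part the
    defining relation of [N] trades the divisor for [M]. *)
Lemma geronimusM (F : fieldType) (M N : {poly F} -> F) (kappa s : F)
    (N_ger : is_geronimus M kappa s N) (p r : {poly F}) :
  N (p * r) = r.[kappa] * N p + M (p * (r %/ ('X - kappa%:P))).
Proof.
have [linN NM _] := N_ger.
rewrite {1}(divp_XsubC r kappa) mulrDr addrC mulrC mul_polyC linN -NM.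
by rewrite mulrA [_ * (p * _)]mulrC.
Qed.

(** This is [geronimusM] for the product [1 * P n]: [N 1] is [s], and the quotient of [P n] is the
    difference quotient inside [second_kind], with both signs flipped. *)
Lemma geronimus_denE (F : fieldType) (M N : {poly F} -> F) (kappa s : F)
    (N_ger : is_geronimus M kappa s N) (P : nat -> {poly F}) (n : nat) :
  geronimus_den M P kappa s n = N (P n).
Proof.
have [_ _ <-] := N_ger; rewrite -[in RHS](mul1r (P n)) (geronimusM N_ger).
rewrite /geronimus_den /second_kind mulrC; congr (_ + M _).
rewrite [X in _ - X](divp_XsubC (P n) kappa) opprD addrCA subrr addr0.
rewrite -mulrN opprB mul1r.
by rewrite mulpK // -opprB oppr_eq0 polyXsubC_eq0.
Qed.

Lemma geronimus_annihilates (F : fieldType) (M : {scalar {poly F}})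
    (N : {poly F} -> F) (kappa s : F) (N_ger : is_geronimus M kappa s N)
    (P : nat -> {poly F}) (P_OPS : is_monic_OPS M P) (n : nat) (r : {poly F}) :
  N (P n) = 0 -> (size r <= n.+1)%N -> N (P n * r) = 0.
Proof.
move=> NPn rn; rewrite (geronimusM N_ger) NPn mulr0 add0r.
rewrite (OPS_orthogonal P_OPS) // size_divp ?polyXsubC_eq0 // size_XsubC.
by rewrite leq_subLR add1n.
Qed.

(** The coefficient in the construction is exactly the one that makes [N] vanish on every
    transformed polynomial of positive degree. Pairing with [q] then reduces to [M] on the quotient
    of [q], one degree lower, where the orthogonality of [P] applies. *)
Lemma is_monic_OPS_geronimus (F : fieldType) (M : {scalar {poly F}})
    (N : {poly F} -> F) (kappa s : F) (N_ger : is_geronimus M kappa s N)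
    (P : nat -> {poly F}) (P_OPS : is_monic_OPS M P)
    (NP_neq0 : forall n, N (P n) <> 0) :
  geronimus_correct M P kappa s /\
  is_monic_OPS N (geronimus_poly M P kappa s).
Proof.
split=> [[|n] //= _|]; first by rewrite (geronimus_denE N_ger).
have [linN _ _] := N_ger; have [Pmonic [Psize Porth PP]] := P_OPS.
set T := geronimus_poly M P kappa s.
have [c TE cE] : exists2 c : nat -> F, forall n, T n.+1 = P n.+1 - c n *: P n &
    forall n, N (P n.+1) = c n * N (P n).
  exists (fun n => N (P n.+1) / N (P n)) => n.
    by rewrite /T /= !(geronimus_denE N_ger).
  by rewrite divfK //; apply/eqP.
have cP n : (size (- (c n *: P n)) < size (P n.+1))%N.
  by rewrite size_polyN Psize ltnS (leq_trans (size_scale_leq _ _)) ?Psize.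
have Tsize n : size (T n) = n.+1.
  case: n => [|n]; first exact: size_poly1.
  by rewrite TE size_polyDl ?cP ?Psize.
have Tmonic n : T n \is monic.
  case: n => [|n]; first exact: monic1.
  by rewrite TE monicE lead_coefDl ?cP -?monicE.
have NT0 n : N (T n.+1) = 0.
  by rewrite TE addrC -scaleNr linN cE mulNr addNr.
have sX : 'X - kappa%:P != 0 :> {poly F} by rewrite polyXsubC_eq0.
have NTM n q : N (T n.+1 * q) =
    M (P n.+1 * (q %/ ('X - kappa%:P))) - c n * M (P n * (q %/ ('X - kappa%:P))).
  rewrite (geronimusM N_ger) NT0 mulr0 add0r TE mulrBl -scalerAl.
  by rewrite linearB scalarZ.
have N0 : N 0 = 0.
  by have := linN (-1) 0 0; rewrite scaler0 addr0 mulN1r addNr.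
have Torth n (q : {poly F}) : (size q <= n)%N -> N (T n * q) = 0.
  case: n => [|n qn].
    by rewrite leqn0 size_poly_eq0 => /eqP ->; rewrite mulr0 N0.
  rewrite NTM.
  have qn' : (size (q %/ ('X - kappa%:P))%R <= n)%N.
    by rewrite size_divp // size_XsubC leq_subLR.
  by rewrite !(OPS_orthogonal P_OPS) ?mulr0 ?subrr // leqW.
split=> //; split=> // [n m nm|[|n]].
- have [nm'|mn|//] := ltngtP n m; last by rewrite Torth // Tsize.
  by rewrite mulrC Torth // Tsize.
(* Both sequences start at 1, so this case is the hypothesis [NP_neq0] at index 0. *)
- have P0 : P 0%N = 1.
    have /size_poly1P[d _ dE] : size (P 0%N) == 1%N by rewrite Psize.
    by have := Pmonic 0%N; rewrite dE monicE lead_coefC => /eqP ->.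
  by rewrite expr1n -P0.
- rewrite expr2 NTM.
  set q := T n.+1 %/ _.
  have qs : size q = n.+1 by rewrite size_divp // size_XsubC Tsize subn1.
  have q_lead : q`_n != 0.
    by rewrite -[n]/(n.+1.-1) -qs -lead_coefE lead_coef_eq0 -size_poly_eq0 qs.
  (* Since [q] has degree [n], the [P n.+1] term vanishes and the [P n] term picks out the leading
     coefficient of [q]. If [c n] were 0, then [N (P n.+1)] would be 0. *)
  rewrite OPS_orthogonal ?qs // (OPS_mul_coef P_OPS) ?qs // sub0r.
  apply/eqP; rewrite oppr_eq0 !mulf_neq0 //; last exact/eqP.
  by apply: contra_notN (NP_neq0 n.+1) => /eqP cn; rewrite cE cn mul0r.
Qed.

(** * Continuous complex functions and their integrals over a segment *)

(** Continuity is stated by components to match [cintegral], which integrates the real and imaginary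
    parts separately. *)
Definition ccontinuous (R : realType) (w : R -> R[i]) :=
  continuous (fun t => complex.Re (w t)) /\ continuous (fun t => complex.Im (w t)).

Lemma ccontinuous_cst (R : realType) (c : R[i]) : ccontinuous (fun=> c : R[i]).
Proof. by split=> t; apply: cvg_cst. Qed.

Lemma ccontinuousD (R : realType) (v w : R -> R[i]) :
  ccontinuous v -> ccontinuous w -> ccontinuous (fun t => v t + w t).
Proof.
move=> [v1 v2] [w1 w2]; split=> t.
  under eq_fun do rewrite raddfD.
  by apply: continuousD; [exact: v1|exact: w1].
under eq_fun do rewrite raddfD.
by apply: continuousD; [exact: v2|exact: w2].
Qed.

Lemma ccontinuousM (R : realType) (v w : R -> R[i]) :
  ccontinuous v -> ccontinuous w -> ccontinuous (fun t => v t * w t).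
Proof.
move=> [v1 v2] [w1 w2]; split=> t.
  rewrite (_ : (fun t => _) = fun t => complex.Re (v t) * complex.Re (w t) -
      complex.Im (v t) * complex.Im (w t)); last first.
    by apply/funext => u; case: (v u) (w u) => [? ?] [].
  by apply: cvgB; apply: cvgM; [exact: v1|exact: w1|exact: v2|exact: w2].
rewrite (_ : (fun t => _) = fun t => complex.Re (v t) * complex.Im (w t) +
    complex.Im (v t) * complex.Re (w t)); last first.
  by apply/funext => u; case: (v u) (w u) => [? ?] [].
by apply: cvgD; apply: cvgM; [exact: v1|exact: w2|exact: v2|exact: w1].
Qed.

Lemma ccontinuous_real (R : realType) (f : R -> R) :
  continuous f -> ccontinuous (fun t => (f t)%:C).
Proof. by move=> fc; split=> //= t; apply: cvg_cst. Qed.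

Lemma ccontinuous_horner (R : realType) (p : {poly R[i]}) :
  ccontinuous (fun t => p.[t%:C]).
Proof.
elim/poly_ind: p => [|p c IH].
  by under eq_fun do rewrite horner0; apply: ccontinuous_cst.
under eq_fun do rewrite hornerMXaddC.
apply: ccontinuousD; last exact: ccontinuous_cst.
by apply: ccontinuousM => //; apply: ccontinuous_real => t; apply: cvg_id.
Qed.

Lemma continuous_integrable_itv (R : realType) (a b : R)
    (mu : {finite_measure set (measurableTypeR R) -> \bar R}) (f : R -> R) :
  continuous f -> mu.-integrable `[a, b] (EFin \o f).
Proof.
move=> fc; apply: measurable_bounded_integrable => //.
- by rewrite ltey_eq fin_num_measure.
- by apply: measurable_funTS; apply: measurable_realfun.continuous_measurable_fun.
- have : compact (f @` `[a, b]).
    by apply: continuous_compact; [exact: continuous_subspaceT|exact: segment_compact].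
  move/compact_bounded => [M [Mr HM]]; exists M; split=> // x Mx t abt.
  by apply: HM => //=; exists t.
Qed.

Lemma density_functional_scalar (R : realType) (a b : R)
    (mu : {finite_measure set (measurableTypeR R) -> \bar R}) (w : R -> R[i]) :
  ccontinuous w -> scalar (density_functional mu `[a, b] w).
Proof.
move=> wc c p q; rewrite /density_functional /cintegral.
have [p1 p2] := ccontinuousM (ccontinuous_horner p) wc.
have [q1 q2] := ccontinuousM (ccontinuous_horner q) wc.
have Hf := continuous_integrable_itv.
have mab : measurable (`[a, b]%classic : set (measurableTypeR R)) by [].
have E t : (c *: p + q).[t%:C] * w t = c * (p.[t%:C] * w t) + q.[t%:C] * w t.
  by rewrite hornerD hornerZ mulrDl mulrA.
have H r (f : R -> R) : continuous f -> continuous (fun t => r * f t).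
  by move=> fc t; apply: cvgM; [exact: cvg_cst|exact: fc].
case: c E => c1 c2 E.
(* Multiplication by [c] mixes the two component integrals; every piece is continuous, hence
   integrable, so each component splits linearly. *)
apply/eqP; rewrite eq_complex /=; apply/andP; split; apply/eqP.
  under eq_Rintegral => t _.
    rewrite E.
    rewrite (_ : complex.Re _ = c1 * complex.Re (p.[t%:C] * w t) -
      c2 * complex.Im (p.[t%:C] * w t) + complex.Re (q.[t%:C] * w t)); last first.
      by case: (_ * w t) (_ * w t) => [? ?] [].
    over.
  rewrite RintegralD // ?RintegralB // ?RintegralZl //; try exact: Hf.
  all: try by apply: Hf; apply: H.
  by apply: Hf => t; apply: cvgB; apply: H.
under eq_Rintegral => t _.
  rewrite E.
  rewrite (_ : complex.Im _ = c1 * complex.Im (p.[t%:C] * w t) +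
      c2 * complex.Re (p.[t%:C] * w t) + complex.Im (q.[t%:C] * w t)); last first.
    by case: (_ * w t) (_ * w t) => [? ?] [].
  over.
rewrite RintegralD // ?RintegralD // ?RintegralZl //; try exact: Hf.
all: try by apply: Hf; apply: H.
by apply: Hf => t; apply: cvgD; apply: H.
Qed.

(** By compactness [1 / g] is bounded by some [C > 0] on the segment, so [f * g] dominates
    [C^-1 * f] there. *)
Lemma Rintegral_mul_gt0 (R : realType) (a b : R)
    (mu : {finite_measure set (measurableTypeR R) -> \bar R}) (f g : R -> R) :
  continuous f -> continuous g -> (forall t, 0 <= f t) -> (forall t, 0 < g t) ->
  0 < \int[mu]_(t in `[a, b]) f t -> 0 < \int[mu]_(t in `[a, b]) (f t * g t).
Proof.
move=> fc gc f0 g0 If.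
have : compact ((fun t => (g t)^-1) @` `[a, b]).
  apply: continuous_compact; last exact: segment_compact.
  by apply: continuous_subspaceT => t; apply: cvgV; [rewrite gt_eqF|exact: gc].
move=> /compact_bounded [M [_ HM]].
(* The bound holds only for constants strictly above [M], hence [M + 1]; the maximum with 1 ensures
   positivity. *)
pose C := Num.max (M + 1) 1.
have C0 : 0 < C by rewrite lt_max ltr01 orbT.
apply: (lt_le_trans (mulr_gt0 (x := C^-1) _ If)); first by rewrite invr_gt0.
rewrite -RintegralZl //; last exact: continuous_integrable_itv.
apply: le_Rintegral => //.
- by apply: continuous_integrable_itv => t; apply: cvgM; [exact: cvg_cst|exact: fc].
- by apply: continuous_integrable_itv => t; apply: cvgM; [exact: fc|exact: gc].
- move=> t abt; rewrite mulrC ler_wpM2l // -[leRHS]invrK lef_pV2 ?posrE ?invr_gt0 //.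
  rewrite -[leLHS]ger0_norm; last by rewrite invr_ge0 ltW.
  apply: (HM C); last by exists t.
  by rewrite lt_max ltrDl ltr01.
Qed.

(** * Conjugate polynomials and the two weights *)

Definition conj_poly (R : realType) (p : {poly R[i]}) : {poly R[i]} :=
  map_poly conjc p.

(** Real points are fixed by conjugation, so there [conj_poly p] takes the conjugate value of
    [p]. *)
Lemma horner_mul_conj_poly (R : realType) (p : {poly R[i]}) (t : R) :
  (p * conj_poly p).[t%:C] =
  (complex.Re p.[t%:C] ^+ 2 + complex.Im p.[t%:C] ^+ 2)%:C.
Proof.
rewrite hornerM add_Re2_Im2 sqr_normc; congr (_ * _).
by rewrite -horner_map; congr _.[_]; rewrite /= oppr0.
Qed.

(** The real-valued form of [1 / |t - kappa|^2]. Both weights are expressed through it, so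
    continuity and positivity are settled over [R]. *)
Definition sqdist_inv (R : realType) (kappa : R[i]) (t : R) : R :=
  ((t - complex.Re kappa) ^+ 2 + complex.Im kappa ^+ 2)^-1.

Lemma sqdist_inv_gt0 (R : realType) (kappa : R[i]) (t : R) :
  complex.Im kappa <> 0 -> 0 < sqdist_inv kappa t.
Proof.
by move=> /eqP k0; rewrite invr_gt0 ltr_wpDl ?sqr_ge0 // exprn_even_gt0.
Qed.

Lemma continuous_sqdist_inv (R : realType) (kappa : R[i]) :
  complex.Im kappa <> 0 -> continuous (sqdist_inv kappa).
Proof.
move=> k0 t; apply: cvgV.
  by rewrite -invr_eq0 gt_eqF // sqdist_inv_gt0.
apply: cvgD; last exact: cvg_cst.
by apply: cvgM; apply: cvgB; [exact: cvg_id|exact: cvg_cst|exact: cvg_id|exact: cvg_cst].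
Qed.

Lemma sqnorm_inv_sub (R : realType) (kappa : R[i]) (t : R) :
  (`|t%:C - kappa| ^+ 2)^-1 = (sqdist_inv kappa t)%:C.
Proof.
rewrite -add_Re2_Im2 -fmorphV; congr (_ + _)^-1%:C; first by case: kappa.
by case: kappa => x y /=; rewrite sub0r sqrrN.
Qed.

Lemma inv_sub (R : realType) (kappa : R[i]) (t : R) :
  (t%:C - kappa)^-1 = (sqdist_inv kappa t)%:C * (t%:C - kappa^*).
Proof.
rewrite invc_norm sqnorm_inv_sub rmorphB; congr (_ * (_ - _)).
by rewrite /= oppr0.
Qed.

Lemma real_sub_neq0 (R : realType) (kappa : R[i]) (t : R) :
  complex.Im kappa <> 0 -> t%:C - kappa != 0.
Proof. by move=> k0; apply/eqP => /subr0_eq E; apply: k0; rewrite -E. Qed.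

(** Serves both rounds: from density 1 to [1 / (t - kappa)] at [kappa], then on to
    [1 / |t - kappa|^2] at the conjugate point. *)
Lemma density_geronimus (R : realType) (a b : R)
    (mu : {finite_measure set (measurableTypeR R) -> \bar R})
    (v w : R -> R[i]) (kappa : R[i]) :
  ccontinuous w -> (forall t, (t%:C - kappa) * w t = v t) ->
  is_geronimus (density_functional mu `[a, b] v) kappa
    (cintegral mu `[a, b] w) (density_functional mu `[a, b] w).
Proof.
move=> wc wv; split=> [|p|]; first exact: density_functional_scalar.
  rewrite /density_functional; congr cintegral; apply/funext => t.
  by rewrite hornerM hornerXsubC -mulrA mulrCA wv.
rewrite /density_functional; congr cintegral; apply/funext => t.
by rewrite hornerC mul1r.
Qed.

Lemma density_conj_poly_neq0 (R : realType) (a b : R)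
    (mu : {finite_measure set (measurableTypeR R) -> \bar R})
    (L_pos : positive_definite (integral_functional mu `[a, b]))
    (kappa : R[i]) (kappa_nonreal : complex.Im kappa <> 0)
    (p : {poly R[i]}) (p_neq0 : p != 0) :
  density_functional mu `[a, b] (fun t => (t%:C - kappa)^-1)
    (p * conj_poly p) <> 0 /\
  density_functional mu `[a, b] (fun t => (`|t%:C - kappa| ^+ 2)^-1)
    (p * conj_poly p) <> 0.
Proof.
set f := fun t : R => complex.Re p.[t%:C] ^+ 2 + complex.Im p.[t%:C] ^+ 2.
have pf t : (p * conj_poly p).[t%:C] = (f t)%:C by exact: horner_mul_conj_poly.
have f0 t : 0 <= f t by rewrite addr_ge0 ?sqr_ge0.
have fc : continuous f.
  have [p1 p2] := ccontinuous_horner p.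
  by move=> t; apply: cvgD; apply: cvgM; [exact: p1|exact: p1|exact: p2|exact: p2].
have If : 0 < \int[mu]_(t in `[a, b]) f t.
  (* The product is [|p|^2] at real points, so positive-definiteness applies; the strict order of
     [R[i]] then yields positivity of the real component. *)
  have := L_pos (p * conj_poly p).
  rewrite /integral_functional /cintegral ltcE /= => /(_ _ _) /andP[].
  - by apply/eqP; rewrite mulf_neq0 // map_poly_eq0.
  - by move=> t; rewrite pf ler0c.
  - by move=> _; under eq_Rintegral => t _ do rewrite pf.
have gc := continuous_sqdist_inv kappa_nonreal.
have g0 t := sqdist_inv_gt0 t kappa_nonreal.
have Ifg := Rintegral_mul_gt0 fc gc f0 g0 If.
split=> /eqP; rewrite eq_complex => /andP[].
- move=> _ /eqP /=.
  under eq_Rintegral => t _.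
    rewrite pf inv_sub.
    rewrite (_ : complex.Im _ = complex.Im kappa * (f t * sqdist_inv kappa t)); last first.
      by case: (kappa) => x y /=; ring.
    over.
  rewrite RintegralZl //; last first.
    by apply: continuous_integrable_itv => t; apply: cvgM; [exact: fc|exact: gc].
  by move/eqP; rewrite mulf_eq0 (gt_eqF Ifg) orbF => /eqP.
- move=> /eqP /= + _.
  under eq_Rintegral => t _.
    rewrite pf sqnorm_inv_sub -rmorphM /=; over.
  by move/eqP; rewrite gt_eqF.
Qed.

Theorem theorem4p10 (R : realType) (a b : R)
    (mu : {finite_measure set (measurableTypeR R) -> \bar R})
    (mu_supp : measure_support mu `<=` `[a, b])
    (L_pos : positive_definite (integral_functional mu `[a, b]))
    (P : nat -> {poly R[i]})
    (P_OPS : is_monic_OPS (integral_functional mu `[a, b]) P)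
    (kappa : R[i]) (kappa_nonreal : complex.Im kappa <> 0) :
  let L := integral_functional mu `[a, b] in
  let w1 := fun t : R => (t%:C - kappa)^-1 in
  let w2 := fun t : R => (`|t%:C - kappa| ^+ 2)^-1 in
  let s1 := cintegral mu `[a, b] w1 in
  let s2 := cintegral mu `[a, b] w2 in
  let P1 := geronimus_poly L P kappa s1 in
  [/\ geronimus_correct L P kappa s1,
      is_OPS (density_functional mu `[a, b] w1) P1
    & forall L1 : {poly R[i]} -> R[i], is_geronimus L kappa s1 L1 ->
        let P2 := geronimus_poly L1 P1 kappa^* s2 in
        geronimus_correct L1 P1 kappa^* s2 /\
        is_OPS (density_functional mu `[a, b] w2) P2].
Proof.
move=> L w1 w2 s1 s2 P1; set D := `[a, b]%classic.
have LE : L = density_functional mu D (fun=> 1).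
  by apply/funext => p; congr cintegral; apply/funext => t; rewrite mulr1.
have g_cont : ccontinuous (fun t => (sqdist_inv kappa t)%:C).
  exact/ccontinuous_real/continuous_sqdist_inv.
have w2E : w2 = fun t => (sqdist_inv kappa t)%:C.
  by apply/funext => t; rewrite /w2 sqnorm_inv_sub.
have w2_cont : ccontinuous w2 by rewrite w2E.
(* This identity gives both the continuity of [w1] and the second Geronimus relation. *)
have w1E t : w1 t = (t%:C - kappa^*) * w2 t by rewrite w2E /w1 inv_sub mulrC.
have w1_cont : ccontinuous w1.
  rewrite (funext w1E : w1 = _); apply: ccontinuousM => //.
  apply: ccontinuousD; last exact: ccontinuous_cst.
  by apply: ccontinuous_real => t; apply: cvg_id.
have linL : scalar L.
  by rewrite LE; apply/density_functional_scalar/ccontinuous_cst.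
pose N1 := density_functional mu D w1; pose N2 := density_functional mu D w2.
have linN1 : scalar N1 by exact: density_functional_scalar.
have N1_ger : is_geronimus L kappa s1 N1.
  by rewrite LE; apply: density_geronimus => // t; rewrite mulfV ?real_sub_neq0.
have N2_ger : is_geronimus N1 kappa^* s2 N2 by apply: density_geronimus.
pose L' : {scalar {poly R[i]}} := HB.pack L (GRing.isLinear.Build _ _ _ _ L linL).
pose N1' : {scalar {poly R[i]}} := HB.pack N1 (GRing.isLinear.Build _ _ _ _ N1 linN1).
have conj_small (p : {poly R[i]}) n : size p = n.+1 -> (size (conj_poly p) <= n.+1)%N.
  by move=> ps; rewrite size_map_poly ps.
have neq0 (p : {poly R[i]}) n : size p = n.+1 -> p != 0.
  by rewrite -size_poly_eq0 => ->.
have Psize := let: conj _ (And3 Ps _ _) := P_OPS in Ps.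
have N1P n : N1 (P n) <> 0.
  move=> /(geronimus_annihilates (M := L') N1_ger P_OPS)/(_ (conj_small _ _ (Psize n))).
  by have [+ _] := density_conj_poly_neq0 L_pos kappa_nonreal (neq0 _ _ (Psize n)).
have [P_correct P1_OPS] := is_monic_OPS_geronimus (M := L') N1_ger P_OPS N1P.
split=> //; first by case: P1_OPS.
move=> L1 L1_ger.
(* A Geronimus transform is determined by its parameter, so [L1] is integration against [w1]. *)
have -> : L1 = N1 by apply/funext; apply: is_geronimus_uniq L1_ger N1_ger.
have P1size := let: conj _ (And3 Ps _ _) := P1_OPS in Ps.
(* Second round: [N1] and [P1] take the places of [L] and [P], while non-vanishing again comes from
   the positivity of [L], now applied to [P1 n] times its conjugate. *)
have N2P n : N2 (P1 n) <> 0.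
  move=> /(geronimus_annihilates (M := N1') N2_ger P1_OPS)/(_ (conj_small _ _ (P1size n))).
  by have [_] := density_conj_poly_neq0 L_pos kappa_nonreal (neq0 _ _ (P1size n)).
have [P1_correct [_ P2_OPS]] := is_monic_OPS_geronimus (M := N1') N2_ger P1_OPS N2P.
by split.
Qed.
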